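(* Let $m,n\in\mathbb{N}$ with $m\le n$, and let $\theta\in(0,1)$. For all $\mu\in \mathrm{M}(\mathbb{R}^m)$ and $\nu\in \mathrm{M}(\mathbb{R}^n)$, $$\inf_{\beta\in\Phi^-(\nu,m)} \mathrm{D}_{\mathrm{JS}}(\mu,\beta)=\inf_{\alpha\in\Phi^+(\mu,n)} \mathrm{D}_{\mathrm{JS}}(\alpha,\nu).$$
   Context: $\mathrm{M}(\mathbb{R}^n)$ is the set of Borel probability measures on $\mathbb{R}^n$. For $m\le n$, $\mathrm{O}(m,n)=\{V\in\mathbb{R}^{m\times n}: VV^{T}=I_m\}$. For $V\in \mathrm{O}(m,n)$, $b\in\mathbb{R}^m$, $\varphi_{V,b}:\mathbb{R}^n\to\mathbb{R}^m$ is $\varphi_{V,b}(x)=Vx+b$, and $\varphi_{V,b}(\mu)=\mu\circ\varphi_{V,b}^{-1}$ is the pushforward measure. For $\mu\in \mathrm{M}(\mathbb{R}^m)$ and $\nu\in \mathrm{M}(\mathbb{R}^n)$, $$\Phi^-(\nu,m)=\{\beta\in \mathrm{M}(\mathbb{R}^m): \varphi_{V,b}(\nu)=\beta \text{ for some } V\in \mathrm{O}(m,n),\ b\in\mathbb{R}^m\},$$ $$\Phi^+(\mu,n)=\{\alpha\in \mathrm{M}(\mathbb{R}^n): \varphi_{V,b}(\alpha)=\mu \text{ for some } V\in \mathrm{O}(m,n),\ b\in\mathbb{R}^m\}.$$ For fixed $\theta\in(0,1)$ and $\mu,\nu\in \mathrm{M}(\mathbb{R}^n)$, the Jensen–Shannon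 divergence is $$\mathrm{D}_{\mathrm{JS}}(\mu,\nu)=\tfrac12 \mathrm{D}_{\mathrm{KL}}(\mu\Vert\zeta)+\tfrac12 \mathrm{D}_{\mathrm{KL}}(\nu\Vert\eta),\qquad \zeta=(1-\theta)\mu+\theta\nu,\quad \eta=(1-\theta)\nu+\theta\mu,$$ where $\mathrm{D}_{\mathrm{KL}}(\mu\Vert\zeta)=\int\log\bigl(\tfrac{d\mu}{d\zeta}\bigr)\,d\mu$ for $\mu$ absolutely continuous with respect to $\zeta$. The same $\theta$ is used on both sides of the claim. *)

(* Defs.v *)
From HB Require Import structures.
From mathcomp Require Import all_boot all_order all_algebra.
From mathcomp Require Import interval_inference.
From mathcomp Require Import all_classical all_reals all_analysis.

Set Implicit Arguments.
Unset Strict Implicit.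
Unset Printing Implicit Defensive.

Import Order.TTheory GRing.Theory Num.Theory.
Import numFieldNormedType.Exports.

Local Open Scope classical_set_scope.
Local Open Scope ring_scope.

(* Column vectors with the Borel sigma-algebra of their product topology. *)
Notation borelV R n := (g_sigma_algebraType (@open 'cV[R]_n)).

Notation borel_prob R n := (probability (borelV R n) R).

Section affine_image.
Context {R : realType}.

Definition orthonormal_rows (m n : nat) : set 'M[R]_(m, n) :=
  [set V | V *m V^T = 1%:M].

Definition affine_map (m n : nat) (V : 'M[R]_(m, n)) (b : 'cV[R]_m)
    (x : 'cV[R]_n) : 'cV[R]_m :=
  V *m x + b.

(* The equality affine_map V b (nu) = beta of Borel measures. It is asserted on
   measurable sets only: measures are functions on all of [set T], whose values
   on non-measurable sets carry no meaning. *)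
Definition is_affine_image (m n : nat) (nu : borel_prob R n)
    (V : 'M[R]_(m, n)) (b : 'cV[R]_m) (beta : borel_prob R m) : Prop :=
  forall A : set (borelV R m), measurable A ->
    pushforward nu (affine_map V b : borelV R n -> borelV R m) A = beta A.

Definition Phi_minus (n : nat) (nu : borel_prob R n) (m : nat)
  : set (borel_prob R m) :=
  [set beta | exists (V : 'M[R]_(m, n)) (b : 'cV[R]_m),
    orthonormal_rows V /\ is_affine_image nu V b beta].

Definition Phi_plus (m : nat) (mu : borel_prob R m) (n : nat)
  : set (borel_prob R n) :=
  [set alpha | exists (V : 'M[R]_(m, n)) (b : 'cV[R]_m),
    orthonormal_rows V /\ is_affine_image alpha V b mu].

End affine_image.
Arguments Phi_minus {R n} nu m _.
Arguments Phi_plus {R m} mu n _.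

Section mixture.
Context d (T : measurableType d) (R : realType).
Variables (theta : {itv R & `]0, 1[}) (mu nu : probability T R).

Definition mixture : set T -> \bar R :=
  measure_add (mscale (1 - theta%:num)%:nng mu) (mscale theta%:num%:nng nu).

HB.instance Definition _ := Measure.on mixture.

Lemma mixtureE (A : set T) :
  mixture A = ((1 - theta%:num)%:E * mu A + theta%:num%:E * nu A)%E.
Proof. by rewrite /mixture measure_addE. Qed.

Let mixture_setT : mixture [set: T] = 1%E.
Proof. by rewrite mixtureE !probability_setT !mule1 -EFinD subrK. Qed.

HB.instance Definition _ :=
  Measure_isProbability.Build _ _ _ mixture mixture_setT.

End mixture.

Section divergence.
Context d (T : measurableType d) (R : realType).
Local Open Scope charge_scope.
Local Open Scope ereal_scope.

(* The value +oo in the absence of absolute continuity is the usual convention;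
   it never occurs in [JS_div], where the first argument is dominated by the
   mixture. *)
Definition KL_div (mu zeta : probability T R) : \bar R :=
  if `[< mu `<< zeta >] then
    \int[mu]_x lne (('d (charge_of_finite_measure mu) '/d zeta) x)
  else +oo.

Definition JS_div (theta : {itv R & `]0, 1[}) (mu nu : probability T R)
  : \bar R :=
  2^-1%:E * KL_div mu (mixture theta mu nu) +
  2^-1%:E * KL_div nu (mixture theta nu mu).

End divergence.

(* Main.v *)
From HB Require Import structures.
Require Import Defs.
From mathcomp Require Import all_boot all_order all_algebra.
From mathcomp Require Import interval_inference.
From mathcomp Require Import all_classical all_reals all_analysis.
From mathcomp Require Import measurable_realfun.
From mathcomp Require Import lra.

(** The left-hand side is at most the right-hand side by data processing:
pushing [alpha] and [nu] forward by the same affine map cannot increase the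
Jensen-Shannon divergence. Conversely, let [beta] be the image of [nu] under
[phi = affine_map V b], and let [g] be the density of the part of [mu] that is
absolutely continuous with respect to [beta]. Let [alpha] have density
[g \o phi] with respect to [nu], plus the image of the singular part of [mu]
under the section [y |-> V^T (y - b)] of [phi]. Then [phi] maps [alpha] to [mu],
and the densities of [alpha] and [nu] in their mixtures are those of [mu] and
[beta] composed with [phi], so both divergences agree. *)

Set Implicit Arguments.
Unset Strict Implicit.
Unset Printing Implicit Defensive.

Import Order.TTheory GRing.Theory Num.Theory.
Import numFieldNormedType.Exports.

Local Open Scope classical_set_scope.
Local Open Scope ring_scope.

(** * Densities with respect to a measure and change of variables *)

Section density.
Context d (T : measurableType d) (R : realType).
Local Open Scope ereal_scope.

(** Real nonnegative values at every point, not just almost everywhere, let [ln] and real arithmetic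
    apply pointwise. *)
Definition is_density (mu : set T -> \bar R) (nu : {measure set T -> \bar R})
    (f : T -> R) : Prop :=
  [/\ measurable_fun setT f, (forall x, (0 <= f x)%R) &
    forall A, measurable A -> mu A = \int[nu]_(x in A) (f x)%:E].

Variables (mu : {finite_measure set T -> \bar R})
  (nu : {sigma_finite_measure set T -> \bar R}) (f : T -> R).
Hypothesis fd : is_density mu nu f.

Lemma density_dominates : mu `<< nu.
Proof.
case: fd => mf f0 muE; apply/null_content_dominatesP => A mA nuA0.
rewrite muE//; apply: null_set_integral => //.
exact/measurable_EFinP/measurable_funTS.
Qed.

(** Uniqueness of densities: both functions have the same integral over every measurable subset of
    [E]. *)
Lemma ae_eq_density (E : set T) : measurable E ->
  ae_eq nu E (Radon_Nikodym_SigmaFinite.f mu nu) (EFin \o f).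
Proof.
case: (fd) => mf f0 muE mE.
apply: integral_ae_eq => //.
- apply: (integrableS measurableT) => //.
  exact: Radon_Nikodym_SigmaFinite.f_integrable density_dominates.
- exact/measurable_funTS/measurable_EFinP.
- move=> A AE mA; rewrite -Radon_Nikodym_SigmaFinite.f_integral//.
    exact: muE.
  exact: density_dominates.
Qed.

Lemma ge0_integral_density (E : set T) (F : T -> \bar R) :
  measurable E -> (forall x, 0 <= F x) -> measurable_fun setT F ->
  \int[mu]_(x in E) F x = \int[nu]_(x in E) (F x * (f x)%:E).
Proof.
move=> mE F0 mF; have numu := density_dominates; case: (fd) => mf f0 muE.
rewrite -(Radon_Nikodym_SigmaFinite.change_of_variables numu)//; last first.
  exact: measurable_funTS.
apply: ae_eq_integral => //.
- apply: emeasurable_funM; apply: measurable_funTS => //.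
  exact: measurable_int (Radon_Nikodym_SigmaFinite.f_integrable numu).
- apply: emeasurable_funM; apply: measurable_funTS => //.
  exact/measurable_EFinP.
- exact/ae_eqe_mul2l/ae_eq_density.
Qed.

Lemma integral_density (F : T -> R) : measurable_fun setT F ->
  \int[mu]_x (F x)%:E = \int[nu]_x (F x * f x)%:E.
Proof.
move=> mF; case: (fd) => mf f0 muE.
rewrite [LHS]integralE [RHS]integralE.
rewrite !ge0_integral_density//; 
  [|exact/measurable_funeneg/measurable_EFinP|
    exact/measurable_funepos/measurable_EFinP].
(* Multiplication by [f x >= 0] commutes with taking positive and negative parts. *)
congr (_ - _); apply: eq_integral => x _.
- by rewrite !funeposE EFinM maxe_pMl ?lee_fin ?mul0e.
- by rewrite !funenegE EFinM -mulNe maxe_pMl ?lee_fin ?mul0e.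
Qed.

End density.

Lemma integral_preimage d d' (X : measurableType d) (Y : measurableType d')
    (R : realType) (nu : {measure set X -> \bar R})
    (beta : {measure set Y -> \bar R}) (phi : X -> Y) (F : Y -> R) :
  measurable_fun setT phi ->
  (forall A, measurable A -> beta A = nu (phi @^-1` A)) ->
  measurable_fun setT F ->
  (\int[beta]_y (F y)%:E = \int[nu]_x (F (phi x))%:E)%E.
Proof.
move=> mphi betaE mF.
(* The two measures are known to agree on measurable sets only, and integrals see no others. *)
rewrite (@eq_measure_integral _ _ _ _ (pushforward nu phi)); last first.
  by move=> A mA _; exact: betaE.
rewrite [LHS]integralE [RHS]integralE.
have mEF : measurable_fun setT (EFin \o F) by exact/measurable_EFinP.
congr (_ - _)%E.
- rewrite (ge0_integral_pushforward mphi nu measurableT).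
  + by rewrite preimage_setT -funepos_comp.
  + exact: measurable_funepos.
  + by [].
- rewrite (ge0_integral_pushforward mphi nu measurableT).
  + by rewrite preimage_setT -funeneg_comp.
  + exact: measurable_funeneg.
  + by [].
Qed.

(** * The Kullback-Leibler divergence through a density *)

Section kl_density.
Context d (T : measurableType d) (R : realType).
Variables (mu zeta : probability T R) (f : T -> R).
Hypothesis fd : is_density mu zeta f.
Local Open Scope charge_scope.
Local Open Scope ereal_scope.

Let D := 'd (charge_of_finite_measure mu) '/d zeta.

Let mD : measurable_fun setT (fine \o D).
Proof.
apply: measurableT_comp => //; apply: (measurable_int zeta).
exact/Radon_Nikodym_integrable/(density_dominates fd).
Qed.

Let D_fin x : D x \is a fin_num.
Proof. exact/Radon_Nikodym_fin_num/(density_dominates fd). Qed.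

Let measurable_lneD : measurable_fun setT (fun x => lne (D x)).
Proof.
rewrite (_ : (fun x => _) = fun x =>
  if (fine (D x) <= 0)%R then -oo else (ln (fine (D x)))%:E); last first.
  by apply/funext => x; rewrite -[in LHS](fineK (D_fin x)).
apply: measurable_fun_ifT => //.
- exact: measurable_fun_ler.
- apply/measurable_EFinP; exact: measurableT_comp.
Qed.

(** The zero set of [f] has [mu]-mass the integral of 0. This allows [lne], which is [-oo] at 0, to
    be replaced by the real-valued [ln]. *)
Lemma density_ae_gt0 : {ae mu, forall x, (0 < f x)%R}.
Proof.
case: (fd) => mf f0 muE.
have mN : measurable (f @^-1` [set 0%R]).
  by rewrite -[X in measurable X]setTI; exact: mf.
exists (f @^-1` [set 0%R]); split => //.
- rewrite muE//; under eq_integral.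
    move=> x /[!inE] /= ->; over.
  by rewrite integral0.
- move=> x /= /negP; rewrite -leNgt => fx0.
  by apply/eqP; rewrite eq_le fx0 f0.
Qed.

Lemma KL_div_density : KL_div mu zeta = \int[zeta]_x (f x * ln (f x))%:E.
Proof.
case: (fd) => mf f0 muE; have dom := density_dominates fd.
rewrite /KL_div asboolT//.
have Df : ae_eq zeta setT D (EFin \o f).
  apply: ae_eq_trans (ae_eq_density fd measurableT).
  exact/ae_eq_sym/ae_eq_Radon_Nikodym_SigmaFinite.
(* [D] and [f] agree [zeta]-almost everywhere, hence [mu]-almost everywhere by domination. *)
have lnDf : ae_eq mu setT (fun x => lne (D x)) (fun x => (ln (f x))%:E).
  have := null_dominates_ae_eq measurableT dom Df.
  by apply: filterS2 density_ae_gt0 => x fx0 /(_ I) -> _; exact: lne_EFin.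
transitivity (\int[mu]_x (ln (f x))%:E).
  apply: ae_eq_integral => //.
  by apply/measurable_EFinP; exact: measurableT_comp.
rewrite (integral_density fd); last exact: measurableT_comp.
by under eq_integral do rewrite mulrC.
Qed.

End kl_density.

(** * Existence and gluing of densities *)

(** The inverse is constant on [{0}], as [0^-1 = 0], and continuous on the open complement. *)
Lemma measurable_inv (R : realType) : measurable_fun [set: R] (@GRing.inv R).
Proof.
rewrite -(setUv [set 0]).
apply/measurable_funU => //; first exact: measurableC.
split.
- apply: (eq_measurable_fun (cst 0 : R -> R)); last exact: measurable_cst.
  by move=> x /[!inE] ->; rewrite invr0.
- apply: open_continuous_measurable_fun.
    exact/closed_openC/accessible_closed_set1/hausdorff_accessible/Rhausdorff.
  by move=> x /[!inE] /eqP x0; exact: inv_continuous.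
Qed.

Lemma exists_density d (T : measurableType d) (R : realType)
    (mu : {finite_measure set T -> \bar R})
    (nu : {sigma_finite_measure set T -> \bar R}) :
  mu `<< nu -> exists f : T -> R, is_density mu nu f.
Proof.
move=> /radon_nikodym_sigma_finite[f [f0 ffin fint muE]].
exists (fine \o f); split.
- apply: measurableT_comp => //; exact: measurable_int fint.
- by move=> x; exact: fine_ge0.
- by move=> A mA; rewrite muE//; apply: eq_integral => x _; rewrite /= fineK.
Qed.

(** Both sides are additive in [A]. This serves the mixture densities, whose formulas differ on [N]
    and off [N]. *)
Lemma density_setU d (T : measurableType d) (R : realType)
    (mu nu : {measure set T -> \bar R}) (N : set T) (f : T -> R) :
  measurable N -> measurable_fun setT f -> (forall x, 0 <= f x) ->
  (forall A, measurable A -> A `<=` N ->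
    mu A = (\int[nu]_(x in A) (f x)%:E)%E) ->
  (forall A, measurable A -> A `<=` ~` N ->
    mu A = (\int[nu]_(x in A) (f x)%:E)%E) ->
  is_density mu nu f.
Proof.
move=> mN mf f0 fN fNC; split => // A mA.
have mAN : measurable (A `&` N) by exact: measurableI.
have mAD : measurable (A `\` N) by exact: measurableD.
have disj : A `&` N `&` (A `\` N) = set0.
  by rewrite setDE setIACA setICr setI0.
rewrite -[A in LHS](setUIDK A N) -[A in RHS](setUIDK A N).
rewrite measureU// ge0_integral_setU//; last 3 first.
- exact/measurable_EFinP/measurable_funTS.
- by move=> x _; rewrite lee_fin.
- exact/disj_set2P.
by congr (_ + _)%E; [apply: fN|apply: fNC] => //; exact: subIsetr.
Qed.

(** The restriction of [mu] to [D] is a finite measure with density [f \_ D] on the whole space, so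
    the global formula applies to it. *)
Lemma ge0_integral_density_on d (T : measurableType d) (R : realType)
    (mu : {finite_measure set T -> \bar R})
    (nu : {sigma_finite_measure set T -> \bar R})
    (D : set T) (f : T -> R) :
  measurable D -> measurable_fun setT f -> (forall x, 0 <= f x) ->
  (forall A, measurable A -> A `<=` D ->
    mu A = (\int[nu]_(x in A) (f x)%:E)%E) ->
  forall (F : T -> \bar R) (A : set T),
    (forall x, 0 <= F x)%E -> measurable_fun setT F ->
    measurable A -> A `<=` D ->
    (\int[mu]_(x in A) F x = \int[nu]_(x in A) (F x * (f x)%:E))%E.
Proof.
move=> mD mf f0 muE F A F0 mF mA AD.
have muD : (mu D < +oo)%E by rewrite ltey_eq fin_num_measure.
pose muD_ : {finite_measure set T -> \bar R} := mfrestr mD muD.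
have fd : is_density muD_ nu (f \_ D).
  split.
  - by apply/(measurable_restrictT _ _).1 => //; exact: measurable_funTS.
  - by move=> x; rewrite patchE; case: ifP.
  - move=> B mB; rewrite /muD_ /= /mfrestr /mrestr muE;
      [|exact: measurableI|exact: subIsetr].
    rewrite integral_mkcondr; apply: eq_integral => x _.
    by rewrite !patchE; case: ifP.
transitivity (\int[muD_]_(x in A) F x)%E.
  apply: eq_measure_integral => B mB BA.
  by rewrite /muD_ /= /mfrestr /mrestr setIidl//; exact: subset_trans AD.
rewrite (ge0_integral_density fd)//.
by apply: eq_integral => x /[!inE] /AD Dx; rewrite patchE mem_set.
Qed.

(** * Lebesgue decomposition and densities in the mixtures *)

Section lebesgue_decomposition.
Context d (T : measurableType d) (R : realType).

(** The singular part of [mu] is its restriction to [N], and [g] is the density of the rest. *)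
Definition lebesgue_decomposition (mu nu : {measure set T -> \bar R})
    (N : set T) (g : T -> R) : Prop :=
  [/\ measurable N, measurable_fun setT g, (forall x, 0 <= g x), nu N = 0%E &
    forall A, measurable A -> A `<=` ~` N ->
      mu A = (\int[nu]_(x in A) (g x)%:E)%E].

Lemma dominates_mixturel (theta : {itv R & `]0, 1[})
    (mu nu : probability T R) :
  mu `<< mixture theta mu nu.
Proof.
apply/null_content_dominatesP => A mA mix0.
have /esym/eqP := etrans (esym mix0) (mixtureE theta mu nu A).
rewrite padde_eq0; [|by rewrite mule_ge0// lee_fin ltW..].
by move=> /andP[]; rewrite mule_eq0 eqe gt_eqF// => /eqP.
Qed.

Lemma dominates_mixturer (theta : {itv R & `]0, 1[})
    (mu nu : probability T R) :
  nu `<< mixture theta mu nu.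
Proof.
apply/null_content_dominatesP => A mA mix0.
have /esym/eqP := etrans (esym mix0) (mixtureE theta mu nu A).
rewrite padde_eq0; [|by rewrite mule_ge0// lee_fin ltW..].
by move=> /andP[_]; rewrite mule_eq0 eqe gt_eqF// => /eqP.
Qed.

(** The even mixture dominates both measures. If [h] and [k] are their densities in it, then [N] is
    the zero set of [k] and [g = h / k]. *)
Lemma exists_lebesgue_decomposition (mu nu : probability T R) :
  exists N g, lebesgue_decomposition mu nu N g.
Proof.
have half_gt0 : (0%:~R : R) < 2^-1 by rewrite invr_gt0.
have half_lt1 : (2^-1 : R) < 1%:~R by rewrite invf_lt1// ltr1n.
pose half : {itv R & `]0, 1[} :=
  @ItvReal R 2^-1 (BRight 0%Z) (BLeft 1%Z) half_gt0 half_lt1.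
have [h hd] := exists_density (@dominates_mixturel half mu nu).
have [k kd] := exists_density (@dominates_mixturer half mu nu).
case: (hd) => mh h0 muE; case: (kd) => mk k0 nuE.
have mN : measurable (k @^-1` [set 0]).
  by rewrite -[X in measurable X]setTI; exact: mk.
have mg : measurable_fun setT (fun x => h x / k x).
  apply: measurable_funM => //.
  exact: measurableT_comp (@measurable_inv R) _.
exists (k @^-1` [set 0]), (fun x => h x / k x); split => //.
- by move=> x; rewrite divr_ge0.
- rewrite [LHS]nuE//; under eq_integral.
    by move=> x /[!inE] /= ->; over.
  by rewrite integral0.
- move=> A mA AN; rewrite (ge0_integral_density kd)//; last 2 first.
  + by move=> x; rewrite lee_fin divr_ge0.
  + exact/measurable_EFinP.
  rewrite [LHS]muE//; apply: eq_integral => x /[!inE] /AN/eqP kx.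
  by rewrite -EFinM divfK.
Qed.

Variable theta : {itv R & `]0, 1[}.
Let t : R := theta%:num.
Let t_gt0 : 0 < t. Proof. by rewrite /t. Qed.
Let Nt_gt0 : 0 < 1 - t. Proof. by rewrite subr_gt0 /t. Qed.

(* The density of [mu] in [(1 - theta) mu + theta nu] and that of [nu] in
   [(1 - theta) nu + theta mu]: off [N] both mixtures are multiples of [nu], and
   on [N] only [mu] has mass. *)
Definition mixture_densityl (N : set T) (g : T -> R) (x : T) : R :=
  if x \in N then (1 - t)^-1 else g x / ((1 - t) * g x + t).

Definition mixture_densityr (N : set T) (g : T -> R) (x : T) : R :=
  if x \in N then 0 else (t * g x + (1 - t))^-1.

Section mixture_density.
Variables (mu nu : probability T R) (N : set T) (g : T -> R).
Hypothesis dec : lebesgue_decomposition mu nu N g.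

Let gt_gt0 (a b : R) x : 0 < a -> 0 < b -> 0 < a * g x + b.
Proof. by case: dec => _ _ g0 _ _ a0 b0; rewrite ltr_wpDl// mulr_ge0// ltW. Qed.

Let measurable_in : measurable_fun setT (fun x : T => x \in N).
Proof.
case: dec => mN *; apply: (measurable_fun_bool true).
by rewrite setTI preimage_mem_true.
Qed.

(** Taken at [(1 - t, t)] for the mixture around [mu] and at [(t, 1 - t)] for the one around
    [nu]. *)
Let integral_affine (a b : R) A :
  0 < a -> 0 < b -> measurable A -> A `<=` ~` N ->
  (a%:E * mu A + b%:E * nu A = \int[nu]_(x in A) (a * g x + b)%:E)%E.
Proof.
case: dec => mN mg g0 nuN muE a0 b0 mA AN; rewrite muE//.
under [RHS]eq_integral do rewrite EFinD EFinM.
rewrite ge0_integralD//.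
- rewrite ge0_integralZl_EFin//.
  + by rewrite integral_cst.
  + by move=> x _; rewrite lee_fin.
  + exact/measurable_EFinP/measurable_funTS.
  + exact: ltW.
- by move=> x _; rewrite mule_ge0 ?lee_fin// ltW.
- by apply/measurable_EFinP/measurable_funTS/measurable_funM.
- by move=> x _; rewrite lee_fin ltW.
Qed.

Let nu_null A : measurable A -> A `<=` N -> nu A = 0%E.
Proof.
by case: dec => mN _ _ nuN _ mA AN; exact: subset_measure0 AN _.
Qed.

Lemma mixture_densityl_ge0 x : 0 <= mixture_densityl N g x.
Proof.
rewrite /mixture_densityl; case: ifP => _; first by rewrite invr_ge0 ltW.
by rewrite divr_ge0// ?(ltW (gt_gt0 _ _ _))//; case: dec.
Qed.

Lemma mixture_densityr_ge0 x : 0 <= mixture_densityr N g x.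
Proof.
rewrite /mixture_densityr; case: ifP => // _.
by rewrite invr_ge0 ltW// gt_gt0.
Qed.

(** The mixture is at least [(1 - theta) mu], which caps the density of [mu] in it. This uniform
    bound is what makes the entropy integrands integrable. *)
Lemma mixture_densityl_le x : mixture_densityl N g x <= (1 - t)^-1.
Proof.
rewrite /mixture_densityl; case: ifP => // _.
rewrite ler_pdivrMr ?gt_gt0// mulrDr mulKf ?gt_eqF//.
by rewrite lerDl mulr_ge0// ?invr_ge0 ltW.
Qed.

Lemma mixture_densityr_le x : mixture_densityr N g x <= (1 - t)^-1.
Proof.
rewrite /mixture_densityr; case: ifP => _; first by rewrite invr_ge0 ltW.
rewrite lef_pV2 ?posrE ?gt_gt0// lerDr mulr_ge0 ?(ltW t_gt0)//.
by case: dec.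
Qed.

Lemma measurable_mixture_densityl : measurable_fun setT (mixture_densityl N g).
Proof.
case: (dec) => mN mg _ _ _; apply: measurable_fun_ifT => //.
apply: measurable_funM => //; apply: (measurableT_comp (@measurable_inv R)).
by apply: measurable_funD => //; exact: measurable_funM.
Qed.

Lemma measurable_mixture_densityr : measurable_fun setT (mixture_densityr N g).
Proof.
case: (dec) => mN mg _ _ _; apply: measurable_fun_ifT => //.
apply: (measurableT_comp (@measurable_inv R)).
by apply: measurable_funD => //; exact: measurable_funM.
Qed.

Lemma mixture_densitylP :
  is_density mu (mixture theta mu nu) (mixture_densityl N g).
Proof.
case: (dec) => mN mg g0 nuN muE.
apply: (density_setU mN measurable_mixture_densityl mixture_densityl_ge0).
(* On [N], where [nu] vanishes, the mixture is [(1 - t) mu]. *)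
- move=> A mA AN.
  under eq_integral => x.
    move=> /[!inE] /AN /mem_set xN; rewrite /mixture_densityl xN; over.
  rewrite integral_cst// [X in (_ * X)%E]mixtureE nu_null// mule0 adde0.
  rewrite muleA -EFinM mulVf.
    by rewrite mul1e.
  by rewrite gt_eqF.
(* Off [N] the mixture has [nu]-density [(1 - t) * g + t], which cancels the denominator and leaves
   [g]. *)
- move=> A mA AN.
  rewrite (@ge0_integral_density_on _ _ _ _ nu (~` N)
     (fun x => (1 - t) * g x + t))//.
  + rewrite [LHS]muE//; apply: eq_integral => x /[!inE] /AN xN.
    rewrite /mixture_densityl memNset// -EFinM divfK// gt_eqF// gt_gt0//.
  + exact: measurableC.
  + by apply: measurable_funD => //; exact: measurable_funM.
  + by move=> x; rewrite ltW// gt_gt0.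
  + by move=> B mB BN; rewrite [LHS]mixtureE integral_affine.
  + by move=> x; rewrite lee_fin mixture_densityl_ge0.
  + exact/measurable_EFinP/measurable_mixture_densityl.
Qed.

Lemma mixture_densityrP :
  is_density nu (mixture theta nu mu) (mixture_densityr N g).
Proof.
case: (dec) => mN mg g0 nuN muE.
apply: (density_setU mN measurable_mixture_densityr mixture_densityr_ge0).
- move=> A mA AN.
  under eq_integral => x.
    move=> /[!inE] /AN /mem_set xN; rewrite /mixture_densityr xN; over.
  by rewrite integral0 [LHS]nu_null.
(* Off [N] the [nu]-density of the mixture cancels against its inverse, leaving the integral of
   1. *)
- move=> A mA AN.
  rewrite (@ge0_integral_density_on _ _ _ _ nu (~` N)
     (fun x => t * g x + (1 - t)))//.
  + rewrite -[LHS]mul1e -integral_cst//; apply: eq_integral => x /[!inE] /AN xN.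
    by rewrite /mixture_densityr memNset// -EFinM mulVf// gt_eqF// gt_gt0.
  + exact: measurableC.
  + by apply: measurable_funD => //; exact: measurable_funM.
  + by move=> x; rewrite ltW// gt_gt0.
  + by move=> B mB BN; rewrite [LHS]mixtureE addeC integral_affine.
  + by move=> x; rewrite lee_fin mixture_densityr_ge0.
  + exact/measurable_EFinP/measurable_mixture_densityr.
Qed.

End mixture_density.
End lebesgue_decomposition.

(** * Entropy estimates and data processing for the Kullback-Leibler divergence *)

(** The convex function [a * ln a] lies above its tangent at [t]. For [a > 0] this is
    [ln (1 + x) <= x] at [x = t / a - 1], multiplied by [a]. *)
Lemma entropy_tangent (R : realType) (a t : R) : 0 <= a -> 0 < t ->
  a * ln t + a <= a * ln a + t.
Proof.
rewrite le_eqVlt => /predU1P[<- t0|a0 t0]; first by rewrite !mul0r !add0r ltW.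
have ta0 : 0 < t / a by rewrite divr_gt0.
have := @le_ln1Dx R (t / a - 1).
have -> : 1 + (t / a - 1) = t / a by lra.
rewrite ln_div ?posrE// => lnt.
have /(ler_wpM2l (ltW a0)) : ln t - ln a <= t / a - 1 by apply: lnt; lra.
rewrite !mulrBr mulrCA divff ?gt_eqF// !mulr1; lra.
Qed.

(** The tangent at 1 gives the lower bound [a - 1]; [ln a < a] gives the upper bound [a * a]. *)
Lemma entropy_bounded (R : realType) (C a : R) : 0 <= a -> a <= C ->
  `|a * ln a| <= 1 + C * C.
Proof.
move=> a0 aC; rewrite ler_norml; apply/andP; split.
  have := entropy_tangent a0 (@ltr01 R); rewrite ln1 mulr0 add0r; nra.
have [->|a_neq0] := eqVneq a 0; first by rewrite mul0r; nra.
have a_gt0 : 0 < a by rewrite lt_neqAle eq_sym a_neq0.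
have := ln_sublinear a_gt0; nra.
Qed.

Lemma bounded_integrable d (T : measurableType d) (R : realType)
    (P : probability T R) (M : R) (F : T -> R) :
  measurable_fun setT F -> (forall x, `|F x| <= M) ->
  P.-integrable setT (EFin \o F).
Proof.
move=> mF FM.
have iM := finite_measure_integrable_cst P M measurableT.
apply: (le_integrable measurableT _ _ iM).
- exact/measurable_EFinP.
- by move=> x _; rewrite lee_fin (le_trans (FM x))//= ler_norm.
Qed.

Section kl_preimage.
Context d d' (X : measurableType d) (Y : measurableType d') (R : realType).
Variables (alpha zeta : probability X R) (mu xi : probability Y R).
Variable (phi : X -> Y).
Hypothesis mphi : measurable_fun setT phi.
Hypothesis muE : forall A, measurable A -> mu A = alpha (phi @^-1` A).
Hypothesis xiE : forall A, measurable A -> xi A = zeta (phi @^-1` A).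
Local Open Scope ereal_scope.

(** When the density on [X] factors through [phi], both divergences are the integral of [q * ln q],
    by change of variables along [phi]. *)
Lemma KL_div_preimage (q : Y -> R) :
  is_density mu xi q -> is_density alpha zeta (q \o phi) ->
  KL_div mu xi = KL_div alpha zeta.
Proof.
move=> qd qd'; rewrite (KL_div_density qd) (KL_div_density qd').
case: (qd) => mq _ _; rewrite (integral_preimage mphi xiE)//.
by apply: measurable_funM => //; exact: measurableT_comp.
Qed.

(* Integrate the tangent inequality of [a * ln a] at [h (phi x) + e], where the
   shift by [e] keeps all integrands bounded. *)
Lemma KL_div_preimage_le (f : X -> R) (h : Y -> R) (C : R) :
  is_density alpha zeta f -> is_density mu xi h ->
  (forall x, f x <= C)%R -> (forall y, h y <= C)%R ->
  KL_div mu xi <= KL_div alpha zeta.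
Proof.
move=> fd hd fC hC; rewrite (KL_div_density fd) (KL_div_density hd).
case: (fd) => mf f0 fE; case: (hd) => mh h0 hE.
(* The shift by [e] costs [e] in total, because [zeta] has mass 1. *)
apply/lee_addgt0Pr => e e0.
have he0 y : (0 < h y + e)%R by rewrite ltr_wpDl.
pose L y := ln (h y + e)%R.
have mL : measurable_fun setT L.
  by apply: measurableT_comp => //; exact: measurable_funD.
(* Here [ln e <= L y], while [ln z < z] gives [L y <= C + e]. *)
have bL a y : (0 <= a -> a <= C -> `|L y * a| <= (`|ln e| + (C + e)) * C)%R.
  move=> a0 aC; rewrite normrM (ger0_norm a0) ler_pM//.
  have : (ln e <= L y)%R by rewrite ler_ln ?posrE// lerDr.
  have := ln_sublinear (he0 y); rewrite -/(L y).
  have := hC y; have := h0 y.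
  have := ler_norm (- ln e)%R; rewrite normrN.
  have := normr_ge0 (ln e).
  by rewrite ler_norml => *; apply/andP; split; lra.
have iF : zeta.-integrable setT (fun x => (f x * ln (f x))%:E).
  apply: (@bounded_integrable _ _ _ _ (1 + C * C)%R).
    by apply: measurable_funM => //; exact: measurableT_comp.
  by move=> x; exact: entropy_bounded.
have iH : xi.-integrable setT (fun y => (h y * ln (h y))%:E).
  apply: (@bounded_integrable _ _ _ _ (1 + C * C)%R).
    by apply: measurable_funM => //; exact: measurableT_comp.
  by move=> x; exact: entropy_bounded.
have iLh : xi.-integrable setT (fun y => (L y * h y)%:E).
  apply: (@bounded_integrable _ _ _ _ ((`|ln e| + (C + e)) * C)%R).
    exact: measurable_funM.
  by move=> x; exact: bL.
have iLf : zeta.-integrable setT (fun x => (L (phi x) * f x)%:E).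
  apply: (@bounded_integrable _ _ _ _ ((`|ln e| + (C + e)) * C)%R).
    by apply: measurable_funM => //; exact: measurableT_comp.
  by move=> x; exact: bL.
have i_f : zeta.-integrable setT (fun x => (f x)%:E).
  by apply: (@bounded_integrable _ _ _ _ C) => // x; rewrite ger0_norm.
have ih : zeta.-integrable setT (fun x => (h (phi x))%:E).
  apply: (@bounded_integrable _ _ _ _ C); first exact: measurableT_comp.
  by move=> x; rewrite ger0_norm.
have ie : zeta.-integrable setT (fun=> e%:E).
  exact: finite_measure_integrable_cst.
have f1 : \int[zeta]_x (f x)%:E = 1 by rewrite -fE// probability_setT.
have h1 : \int[zeta]_x (h (phi x))%:E = 1.
  by rewrite -(integral_preimage mphi xiE)// -hE// probability_setT.
(* The sides are the integrals of [L] against [mu] and of [L \o phi] against [alpha], equal since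
   [mu] is the image of [alpha]. *)
have LE : \int[xi]_y (L y * h y)%:E = \int[zeta]_x (L (phi x) * f x)%:E.
  rewrite -(integral_density hd)// -(integral_density fd).
    exact: integral_preimage.
  exact: measurableT_comp.
(* Monotonicity of [ln] where [h y > 0]; both integrands vanish where [h y = 0]. *)
apply: (@le_trans _ _ (\int[xi]_y (L y * h y)%:E)).
  apply: le_integral => // y _; rewrite lee_fin [leRHS]mulrC.
  have [->|hy] := eqVneq (h y) 0%R; first by rewrite !mul0r.
  have hy0 : (0 < h y)%R by rewrite lt_neqAle eq_sym hy h0.
  by rewrite ler_wpM2l// ler_ln ?posrE// lerDl ltW.
(* The added 1 is the integral of [f] on the left and of [h \o phi] on the right, which turns the
   claim into the integrated tangent inequality. *)
rewrite LE -(@leeD2rE _ 1)//.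
have e1 : \int[zeta]_x e%:E = e%:E.
  by rewrite integral_cst// [X in _ * X]probability_setT mule1.
rewrite -[in leLHS]f1 -[X in _ <= _ + X]h1 -e1 -integralD//.
rewrite -addeA -integralD// -integralD//; last exact: integrableD.
apply: le_integral => //.
- exact: integrableD.
- by apply: integrableD => //; exact: integrableD.
- move=> x _; rewrite -!EFinD lee_fin [(L _ * _)%R]mulrC.
  by rewrite [(e + _)%R]addrC; exact: entropy_tangent.
Qed.

End kl_preimage.

(** * Construction of measures *)

(** An identity wrapper: the proof of mass one is an argument so that a probability structure can be
    attached. *)
Definition probability_of d (T : measurableType d) (R : realType)
    (mu : {measure set T -> \bar R}) & mu setT = 1%E : set T -> \bar R := mu.

Section probability_of.
Context d (T : measurableType d) (R : realType).
Variables (mu : {measure set T -> \bar R}) (mu1 : mu setT = 1%E).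

HB.instance Definition _ := Measure.on (probability_of mu1).
HB.instance Definition _ :=
  Measure_isProbability.Build _ _ _ (probability_of mu1) mu1.

End probability_of.

Lemma exists_pushforward d d' (X : measurableType d) (Y : measurableType d')
    (R : realType) (mu : {measure set X -> \bar R}) (phi : X -> Y) :
  measurable_fun setT phi ->
  exists nu : {measure set Y -> \bar R}, forall A, nu A = mu (phi @^-1` A).
Proof.
move=> mphi; unshelve eexists (pushforward mu phi : {measure set Y -> \bar R}).
  exact: mphi.
by [].
Qed.

Lemma exists_density_measure d (T : measurableType d) (R : realType)
    (nu : {measure set T -> \bar R}) (f : T -> R) :
  measurable_fun setT f -> (forall x, 0 <= f x) ->
  exists mu : {measure set T -> \bar R},
    forall A, mu A = (\int[nu]_(x in A) (f x)%:E)%E.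
Proof.
move=> mf f0.
pose F A := (\int[nu]_(x in A) (f x)%:E)%E.
have F0 : F set0 = 0%E by rewrite /F integral_set0.
have F_ge0 A : (0 <= F A)%E by apply: integral_ge0 => x _; rewrite lee_fin.
have Fs : semi_sigma_additive F.
  by apply: semi_sigma_additive_nng_induced => //; exact/measurable_EFinP.
pose mu : {measure set T -> \bar R} :=
  HB.pack F (isMeasure.Build _ _ _ F F0 F_ge0 Fs).
by exists mu.
Qed.

(** * The Jensen-Shannon divergence along a map *)

Section js_preimage.
Context d d' (X : measurableType d) (Y : measurableType d') (R : realType).
Variable theta : {itv R & `]0, 1[}.
Variables (phi : X -> Y) (mphi : measurable_fun setT phi).

Lemma mixture_preimage
    (alpha nu : probability X R) (mu beta : probability Y R) :
  (forall A, measurable A -> mu A = alpha (phi @^-1` A)) ->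
  (forall A, measurable A -> beta A = nu (phi @^-1` A)) ->
  forall A, measurable A ->
    mixture theta mu beta A = mixture theta alpha nu (phi @^-1` A).
Proof. by move=> muE betaE A mA; rewrite !mixtureE muE// betaE. Qed.

Variables (alpha nu : probability X R) (mu beta : probability Y R).
Hypothesis muE : forall A, measurable A -> mu A = alpha (phi @^-1` A).
Hypothesis betaE : forall A, measurable A -> beta A = nu (phi @^-1` A).

(** Mixture densities are pointwise expressions in [N] and [g], so those of the pulled-back
    decomposition are, by conversion, those on [Y] composed with [phi]. *)
Lemma JS_div_preimage (N : set Y) (g : Y -> R) :
  lebesgue_decomposition mu beta N g ->
  lebesgue_decomposition alpha nu (phi @^-1` N) (g \o phi) ->
  JS_div theta mu beta = JS_div theta alpha nu.
Proof.
move=> dec dec'; rewrite /JS_div; congr (_ * _ + _ * _)%E.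
- apply: (KL_div_preimage mphi (mixture_preimage muE betaE)
    (mixture_densitylP theta dec)).
  exact: (mixture_densitylP theta dec').
- apply: (KL_div_preimage mphi (mixture_preimage betaE muE)
    (mixture_densityrP theta dec)).
  exact: (mixture_densityrP theta dec').
Qed.

(** Data processing in each of the two terms, with [(1 - t)^-1] as the common bound on all
    densities. *)
Lemma JS_div_preimage_le : (JS_div theta mu beta <= JS_div theta alpha nu)%E.
Proof.
have [N [g dec]] := exists_lebesgue_decomposition mu beta.
have [N' [g' dec']] := exists_lebesgue_decomposition alpha nu.
rewrite /JS_div; apply: leeD; rewrite lee_wpmul2l ?lee_fin//.
- apply: (KL_div_preimage_le mphi muE (mixture_preimage muE betaE)
    (mixture_densitylP theta dec') (mixture_densitylP theta dec)).
  + by move=> x; exact: mixture_densityl_le dec' x.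
  + by move=> x; exact: mixture_densityl_le dec x.
- apply: (KL_div_preimage_le mphi betaE (mixture_preimage betaE muE)
    (mixture_densityrP theta dec') (mixture_densityrP theta dec)).
  + by move=> x; exact: mixture_densityr_le dec' x.
  + by move=> x; exact: mixture_densityr_le dec x.
Qed.

End js_preimage.

(** * Lifting a measure along a map with a section *)

Lemma exists_lift d d' (X : measurableType d) (Y : measurableType d')
    (R : realType) (phi : X -> Y) (psi : Y -> X)
    (nu : probability X R) (mu beta : probability Y R)
    (N : set Y) (g : Y -> R) :
  measurable_fun setT phi -> measurable_fun setT psi -> cancel psi phi ->
  (forall A, measurable A -> beta A = nu (phi @^-1` A)) ->
  lebesgue_decomposition mu beta N g ->
  exists alpha : probability X R,
    (forall A, measurable A -> mu A = alpha (phi @^-1` A)) /\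
    lebesgue_decomposition alpha nu (phi @^-1` N) (g \o phi).
Proof.
move=> mphi mpsi psiK betaE [mN mg g0 betaN muE].
have mgphi : measurable_fun setT (g \o phi) by exact: measurableT_comp.
have [m1 m1E] := exists_density_measure nu mgphi (fun x => g0 (phi x)).
have [m2 m2E] := exists_pushforward (mrestr mu mN) mpsi.
have mE A : measure_add m1 m2 A =
    (\int[nu]_(x in A) (g (phi x))%:E + mu (psi @^-1` A `&` N))%E.
  by rewrite measure_addE m1E m2E.
have mphi_ A : measurable A -> measurable (phi @^-1` A).
  by move=> mA; rewrite -[X in measurable X]setTI; exact: mphi.
have mphiE A : measurable A -> measure_add m1 m2 (phi @^-1` A) = mu A.
  move=> mA; rewrite mE -comp_preimage (_ : phi \o psi = id); last first.
    by apply/funext => y; exact: psiK.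
  have mgE : measurable_fun A (EFin \o g).
    exact/measurable_EFinP/measurable_funTS.
  have mAN : measurable (A `\` N) by exact: measurableD.
  have mAI : measurable (A `&` N) by exact: measurableI.
  transitivity (\int[beta]_(y in A) (g y)%:E + mu (A `&` N))%E.
    congr (_ + _)%E.
    rewrite (@eq_measure_integral _ _ _ A (pushforward nu phi)).
      by rewrite (ge0_integral_pushforward mphi)// => y _; rewrite lee_fin.
    by move=> B mB _; exact: betaE.
  (* Dropping the [beta]-null set [N] leaves the integral of [g] over [A \ N], which is the
     [mu]-mass of that set. *)
  rewrite (ge0_negligible_integral mN mA mgE)//; last first.
    by move=> y _; rewrite lee_fin.
  rewrite -muE//.
  rewrite addeC -measureU//; first by rewrite setUIDK.
  by rewrite setDE setIACA setICr setI0.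
have m1' : measure_add m1 m2 setT = 1%E.
  by rewrite -(probability_setT mu) -mphiE// preimage_setT.
exists (probability_of m1'); split; first by move=> A mA; rewrite -mphiE.
split => //.
- exact: mphi_.
- by move=> x; exact: g0.
- exact: etrans (esym (betaE _ mN)) betaN.
(* The singular summand vanishes here: [psi y] in [A] forces [y = phi (psi y)] outside [N]. *)
- move=> A mA AN; rewrite [LHS]mE.
  rewrite (_ : psi @^-1` A `&` N = set0) ?measure0 ?adde0//.
  by rewrite -subset0 => y [/= /AN]; rewrite /= psiK.
Qed.

(** * Affine maps and their sections *)

(** [V *m y] is a linear combination of the columns of [V] whose coefficients are the coordinates of
    [y], which are continuous. *)
Lemma continuous_affine_map (R : realType) (m n : nat) (V : 'M[R]_(m, n))
    (b : 'cV[R]_m) : continuous (affine_map V b).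
Proof.
have cV : continuous (fun y : 'cV[R]_n => \sum_k y k ord0 *: col k V).
  apply: continuous_big => [|k _ y]; first exact: add_continuous.
  exact: (cvgZr_tmp (@coord_continuous R n 1 k ord0 y)).
have VE y : V *m y = \sum_k y k ord0 *: col k V.
  apply/matrixP => i j; rewrite mxE summxE.
  by apply: eq_bigr => k _; rewrite !mxE mulrC ord1.
rewrite (_ : affine_map V b = fun y => \sum_k y k ord0 *: col k V + b).
  by move=> x; apply: (cvgD (cV x)); exact: cvg_cst.
by apply/funext => y; rewrite /affine_map VE.
Qed.

Lemma measurable_affine_map (R : realType) (m n : nat) (V : 'M[R]_(m, n))
    (b : 'cV[R]_m) :
  measurable_fun setT (affine_map V b : borelV R n -> borelV R m).
Proof.
apply: (@measurability _ _ (borelV R n) (borelV R m) _ _ (@open 'cV[R]_m)).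
  by [].
move=> _ [U oU <-]; rewrite setTI.
apply: sub_sigma_algebra.
by apply: open_comp => // x _; exact: continuous_affine_map.
Qed.

(** The section [y |-> V^T (y - b)] is written as an affine map so that its measurability comes from
    the same lemma. *)
Lemma affine_mapK (R : realType) (m n : nat) (V : 'M[R]_(m, n)) (b : 'cV[R]_m) :
  orthonormal_rows V -> cancel (affine_map V^T (- (V^T *m b))) (affine_map V b).
Proof.
move=> VV y; rewrite /affine_map mulmxDr mulmxN !mulmxA VV !mul1mx.
by rewrite subrK.
Qed.

Theorem mainTheorem2 (R : realType) (m n : nat) (hmn : (m <= n)%N)
    (theta : {itv R & `]0, 1[})
    (mu : borel_prob R m) (nu : borel_prob R n) :
  ereal_inf [set JS_div theta mu beta | beta in Phi_minus nu m] =
  ereal_inf [set JS_div theta alpha nu | alpha in Phi_plus mu n].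
Proof.
apply/eqP; rewrite eq_le; apply/andP; split; apply: le_ereal_inf_tmp.
(* The pair [V], [b] that sends [alpha] to [mu] sends [nu] to a competitor [beta] with no larger
   divergence. *)
- move=> _ [alpha [V [b [VV alphaE]]] <-]; apply: ge_ereal_inf.
  have mphi := measurable_affine_map V b.
  have [m1 m1E] := exists_pushforward nu mphi.
  have m1T : m1 setT = 1%E.
    by rewrite m1E preimage_setT; exact: probability_setT.
  pose beta : borel_prob R m := probability_of m1T.
  have betaE A : measurable A -> beta A = nu (affine_map V b @^-1` A).
    by move=> _; exact: m1E.
  exists (JS_div theta mu beta).
    exists beta => //; exists V, b; split => // A mA.
    exact: esym (betaE A mA).
  by apply: (JS_div_preimage_le _ mphi) => // A mA; exact: esym (alphaE A mA).
(* The pair that sends [nu] to [beta] is used to lift [mu] to a competitor [alpha] with equal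
   divergence. *)
- move=> _ [beta [V [b [VV betaE]]] <-]; apply: ge_ereal_inf.
  have mphi := measurable_affine_map V b.
  have mpsi := measurable_affine_map V^T (- (V^T *m b)).
  have betaE' A : measurable A -> beta A = nu (affine_map V b @^-1` A).
    by move=> mA; exact: esym (betaE A mA).
  have [N [g dec]] := exists_lebesgue_decomposition mu beta.
  have [alpha [muE dec']] :=
    exists_lift mphi mpsi (affine_mapK b VV) betaE' dec.
  exists (JS_div theta alpha nu).
    exists alpha => //; exists V, b; split => // A mA.
    exact: esym (muE A mA).
  by rewrite (JS_div_preimage theta mphi muE betaE' dec dec').
Qed.
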